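(* Let $(x,y)\in\mathbb{R}^2$ with $x>0$ and $x+y>0$, and define sequences $\{x_n\}$, $\{y_n\}$ by $(x_0,y_0)=(x,y)$ and $(x_{n+1},y_{n+1})=(\mu_1(x_n,y_n),\mu_2(x_n,y_n))$ for $n\ge0$. Then $\{x_n\}$ and $\{y_n\}$ converge as $n\to\infty$, and $$\lim_{n\to\infty}x_n=\lim_{n\to\infty}y_n>0.$$
   Context: On $\mathbb{S}_{(-1,\infty)}=\{(x,y)\in\mathbb{R}^2\mid x>0,\ x+y>0\}$ put $\mu_0(x,y)=\sqrt{x\cdot\frac{x+y}{2}}$ (positive square root), $\mu_1(x,y)=m_A(x,\mu_0(x,y))$ and $\mu_2(x,y)=\nu(x,\mu_0(x,y))$, where $m_A(x,y)=\frac{x+y}{2}$, $m_H(x,y)=\frac{2xy}{x+y}$ and $\nu(x,y)=2m_H(x,y)-m_A(x,y)$. Explicitly $\mu_1(x,y)=\frac{2x+\sqrt{2x(x+y)}}{4}$ and $\mu_2(x,y)=\frac{6\sqrt{2x(x+y)}-y-3x}{2(2x+\sqrt{2x(x+y)})}\cdot x$. The map $(\mu_1,\mu_2)$ sends $\mathbb{S}_{(-1,\infty)}$ into itself, so the sequences are well defined. *)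

(* Defs.v *)
From Stdlib Require Import Reals.
From Coquelicot Require Import Coquelicot.

Open Scope R_scope.

(* The set S_(-1,oo), as a predicate on pairs of coordinates.  On it no square
   root below has a negative argument and no denominator vanishes. *)
Definition in_S (x y : R) : Prop := 0 < x /\ 0 < x + y.

Definition m_A (x y : R) : R := (x + y) / 2.
Definition m_H (x y : R) : R := 2 * x * y / (x + y).
Definition nu (x y : R) : R := 2 * m_H x y - m_A x y.

Definition mu0 (x y : R) : R := sqrt (x * ((x + y) / 2)).
Definition mu1 (x y : R) : R := m_A x (mu0 x y).
Definition mu2 (x y : R) : R := nu x (mu0 x y).

Fixpoint mu_iter (x y : R) (n : nat) : R * R :=
  match n with
  | O => (x, y)
  | S k => let p := mu_iter x y k in (mu1 (fst p) (snd p), mu2 (fst p) (snd p))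
  end.

Definition x_seq (x y : R) (n : nat) : R := fst (mu_iter x y n).
Definition y_seq (x y : R) (n : nat) : R := snd (mu_iter x y n).

(* Main.v *)
Require Import Defs.
From Stdlib Require Import Reals.
From Coquelicot Require Import Coquelicot.
From Stdlib Require Import Lra.

Open Scope R_scope.

(** The map [(mu1, mu2)] is Gauss's arithmetic-geometric mean iteration in
    disguise.  In place of [y], use the coordinate [g = mu0 x y]; since
    [g^2 = x * (x + y) / 2], the point [y = 2 * g^2 / x - x] is recovered from
    [x] and [g].  By definition [mu1 x y = (x + g) / 2].  Moreover
    [mu1 x y + mu2 x y = 2 * m_H x g], because the arithmetic mean in [mu1]
    cancels the one subtracted in [nu]; hence the next value of [g^2] is
    [m_A x g * m_H x g = x * g], and the next [g] is the geometric mean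
    [sqrt (x * g)] ([mu0_step]).

    So the pairs [(x_n, g_n)] follow the arithmetic-geometric mean iteration,
    whose two components have a common positive limit [l] ([agm_converges]),
    and [y_n = 2 * g_n^2 / x_n - x_n] tends to [2 * l^2 / l - l = l]. *)

Lemma mu0_sqr (x y : R) : in_S x y -> mu0 x y * mu0 x y = x * ((x + y) / 2).
Proof.
  intros [hx hs]; unfold mu0.
  apply sqrt_sqrt, Rlt_le, Rmult_lt_0_compat; lra.
Qed.

Lemma mu0_pos (x y : R) : in_S x y -> 0 < mu0 x y.
Proof.
  intros [hx hs]; unfold mu0.
  apply sqrt_lt_R0, Rmult_lt_0_compat; lra.
Qed.

Lemma y_from_mu0 (x y : R) :
  in_S x y -> y = 2 * (mu0 x y * mu0 x y) / x - x.
Proof.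
  intros h; rewrite (mu0_sqr x y h); destruct h as [hx _].
  field; lra.
Qed.

Lemma mu1_plus_mu2 (x y : R) : mu1 x y + mu2 x y = 2 * m_H x (mu0 x y).
Proof. unfold mu1, mu2, nu; ring. Qed.

Lemma mu_in_S (x y : R) : in_S x y -> in_S (mu1 x y) (mu2 x y).
Proof.
  intros h; pose proof (mu0_pos x y h) as hg; destruct h as [hx _].
  split.
  - unfold mu1, m_A; lra.
  - rewrite mu1_plus_mu2; unfold m_H.
    apply Rmult_lt_0_compat; [lra|].
    apply Rdiv_lt_0_compat; [|lra].
    apply Rmult_lt_0_compat; lra.
Qed.

(** The geometric mean of the arithmetic and harmonic means of two numbers is
    their own geometric mean. *)
Lemma mu0_step (x y : R) :
  in_S x y -> mu0 (mu1 x y) (mu2 x y) = sqrt (x * mu0 x y).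
Proof.
  intros h; pose proof (mu0_pos x y h) as hg; destruct h as [hx _].
  unfold mu0 at 1; f_equal.
  rewrite mu1_plus_mu2; unfold mu1, m_A, m_H.
  field; lra.
Qed.

Lemma sqrt_mult_le_mean (a b : R) :
  0 < a -> 0 < b -> sqrt (a * b) <= (a + b) / 2.
Proof.
  intros ha hb.
  apply Rsqr_incr_0_var; [|lra].
  rewrite Rsqr_sqrt by (apply Rlt_le, Rmult_lt_0_compat; assumption).
  pose proof (Rle_0_sqr (a - b)); unfold Rsqr in *; lra.
Qed.

(** From index 1 on, [b n <= a n] by the inequality of the means, so [a]
    decreases, [b] increases, and [a] is bounded below by [b 1 > 0].  Once [a]
    has a limit [l], so does [b], because [b n = 2 * a (S n) - a n]. *)
Lemma agm_converges (a b : nat -> R) :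
  (forall n, 0 < a n) -> (forall n, 0 < b n) ->
  (forall n, a (S n) = (a n + b n) / 2) ->
  (forall n, b (S n) = sqrt (a n * b n)) ->
  exists l : R, is_lim_seq a l /\ is_lim_seq b l /\ 0 < l.
Proof.
  intros apos bpos aS bS.
  assert (ba : forall n, b (S n) <= a (S n)).
  { intros n; rewrite aS, bS; apply sqrt_mult_le_mean; auto. }
  assert (adecr : forall n, a (S (S n)) <= a (S n)).
  { intros n; rewrite (aS (S n)); pose proof (ba n); lra. }
  assert (bincr : forall n, b (S n) <= b (S (S n))).
  { intros n; rewrite (bS (S n)).
    rewrite <- (sqrt_square (b (S n))) at 1 by (apply Rlt_le, bpos).
    apply sqrt_le_1_alt, Rmult_le_compat_r; [apply Rlt_le, bpos | apply ba]. }
  assert (b1a : forall n, b 1%nat <= a (S n)).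
  { intros n; apply Rle_trans with (b (S n)); [|apply ba].
    induction n as [|n IH]; [lra|].
    apply Rle_trans with (1 := IH), bincr. }
  destruct (ex_finite_lim_seq_decr (fun n => a (S n)) (b 1%nat) adecr b1a)
    as [l hl].
  assert (ha : is_lim_seq a l) by (apply is_lim_seq_incr_1; exact hl).
  exists l; split; [exact ha|split].
  - apply is_lim_seq_ext with (fun n => 2 * a (S n) - a n).
    { intros n; rewrite aS; field. }
    replace l with (2 * l - l) by ring.
    apply is_lim_seq_minus'; [|exact ha].
    exact (is_lim_seq_scal_l _ 2 _ hl).
  - apply Rlt_le_trans with (b 1%nat); [apply bpos|].
    exact (is_lim_seq_le _ _ (b 1%nat) l b1a (is_lim_seq_const _) hl).
Qed.

Theorem lemma6p12 (x y : R) (hxy : in_S x y) :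
  exists l : R,
    is_lim_seq (x_seq x y) (Finite l) /\
    is_lim_seq (y_seq x y) (Finite l) /\
    0 < l.
Proof.
  set (g := fun n => mu0 (x_seq x y n) (y_seq x y n)).
  assert (hS : forall n, in_S (x_seq x y n) (y_seq x y n)).
  { induction n as [|n IH]; [exact hxy|exact (mu_in_S _ _ IH)]. }
  destruct (agm_converges (x_seq x y) g) as [l [hx [hg lpos]]].
  - intros n; apply hS.
  - intros n; apply mu0_pos, hS.
  - reflexivity.
  - intros n; exact (mu0_step _ _ (hS n)).
  - exists l; split; [exact hx|split; [|exact lpos]].
    apply is_lim_seq_ext with
      (fun n => 2 * (g n * g n) / x_seq x y n - x_seq x y n).
    { intros n; symmetry; exact (y_from_mu0 _ _ (hS n)). }
    replace l with (2 * (l * l) / l - l) by (field; lra).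
    apply is_lim_seq_minus'; [|exact hx].
    apply is_lim_seq_div'; [|exact hx|lra].
    apply (is_lim_seq_scal_l _ 2 (l * l)).
    apply is_lim_seq_mult'; exact hg.
Qed.
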